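(* Consider the kinetic equation $\frac{\partial f}{\partial t}+\boldsymbol v(\boldsymbol\xi)\cdot\nabla_{\boldsymbol x}f=Q[f]$ on $M$, an open subset of a topological vector space $V$ of real-valued functions on a manifold $\boldsymbol\Xi$, with a Riemannian metric $g$ on $M$, and with the equilibrium assumption (E) in force (equilibrium manifold $\iota:\tilde M\to M$, projection $\pi$). Suppose that the equation satisfies the H-theorem, with function $H$, and that $g$ satisfies the following: for each $f\in M$ there is a strictly positive Radon measure $\mu^f$ on $\boldsymbol\Xi$ such that $g|_f(h_1,h_2)=\int_{\boldsymbol\Xi}h_1h_2\,\mathrm d\mu^f$ for all $h_1,h_2\in T_fM$, and $$g(\cdot,\cdot)|_{\iota(\tilde f)}=\partial^2H(\tilde f)\quad\text{for each }\tilde f\in\tilde M.$$ Then the kinetic equation satisfies GWSC on $(M,g)$.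
   Context: Setting: $T_fM=V$; the equation is the first-order equation $\partial_tf+\sum_{j=1}^dA^j\partial_{x^j}f=Q[f]$ where $A^j$ is multiplication by $v^j(\boldsymbol\xi)$ (identities involving $v^jh$ are understood for $h$ in the domain of $A^j$), $\boldsymbol v=(v^1,\dots,v^d):\boldsymbol\Xi\to\mathbb R^d$, and $Q$ is a smooth tangent vector field on $M$. A Radon measure is strictly positive if it is positive on nonempty open sets. Equilibrium set: $\tilde M:=\{f\in M:Q[f]=0\}$. Equilibrium assumption (E): $\tilde M$ is a smooth embedded submanifold of $M$, with embedding $\iota$, and there is a smooth map $\pi$ from an open subset of $M$ containing $\tilde M$ to $\tilde M$ with $\pi\circ\iota=\mathrm{id}_{\tilde M}$ and $g(h,\iota_*\tilde h)|_{\iota(\tilde f)}=\tilde g(\pi_*h,\tilde h)|_{\tilde f}$ for all $\tilde f\in\tilde M$, $h\in T_{\iota(\tilde f)}M$, $\tilde h\in T_{\tilde f}\tilde M$, where $\tilde g:=\iota^*g$. Collision invariants: $\mathbb E:=\{\mathfrak c\in V^*:\langle\mathfrak c,Q[f]\rangle=0\ \forall f\in M\}$. H-theorem: the equation satisfies the H-theorem if there is a real-valued function $H$ defined on a convex open set $U\subset V$ containing $\tilde M$, with strictly positive definite second-order Fréchet derivative $\partial^2H(f)$ for each $f\in U$, such that (H1) $\partial H(\tilde f)\in\mathbb E$ for each $\tilde f\in\tilde M$; (H2) for each $f\in U\cap M$, $S(f):=\langle\partial H(f),Q[f]\rangle\le0$, with equality if and only if $f\in\tilde M$. GWSC (generalized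 weak stability condition) on $(M,g)$: (i) for each $\tilde f\in\tilde M$ and $h\in T_{\iota(\tilde f)}M$, $D_{\iota_*\pi_*h}Q|_{\iota(\tilde f)}=0$ and $\iota_*\pi_*D_hQ|_{\iota(\tilde f)}=0$; (ii) $g(A^jX,Y)=g(X,A^jY)$ for all $X,Y\in\Gamma(TM)$ and $j=1,\dots,d$; (v) $g(D_hQ,h)|_{\iota(\tilde f)}\le0$ for each $\tilde f\in\tilde M$, $h\in T_{\iota(\tilde f)}M$. Here $D$ is the Levi-Civita connection; since $Q$ vanishes on $\tilde M$, $D_hQ|_{\iota(\tilde f)}$ is simply the directional derivative of $Q$ at $\tilde f$ along $h$. *)

(* Defs.v *)
From HB Require Import structures.
From mathcomp Require Import all_boot all_order all_algebra.
From mathcomp Require Import all_classical all_reals all_analysis.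

Set Implicit Arguments.
Unset Strict Implicit.
Unset Printing Implicit Defensive.

Import Order.TTheory GRing.Theory Num.Theory.
Import numFieldNormedType.Exports.

Local Open Scope classical_set_scope.
Local Open Scope ring_scope.

(* A topological vector space is a [topologicalLmodType R]; local convexity
   and a uniform structure (as in [tvsType R]) are not assumed.  The library
   has the product only for [tvsType], hence this alias of [V * W]. *)
Definition tvs_prod (R : realType) (V W : topologicalLmodType R) : Type :=
  (V * W)%type.

HB.instance Definition _ (R : realType) (V W : topologicalLmodType R) :=
  GRing.Lmodule.copy (tvs_prod V W) (V * W)%type.
HB.instance Definition _ (R : realType) (V W : topologicalLmodType R) :=
  Topological.copy (tvs_prod V W) (V * W)%type.

Fact tvs_prod_add_continuous (R : realType) (V W : topologicalLmodType R) :
  continuous (fun x : tvs_prod V W * tvs_prod V W => x.1 + x.2).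
Proof.
move=> [[x1 y1] [x2 y2]] /= U [[A B] /= [nA nB] nU].
have [/= A0 [A01 A02] nA1] := @add_continuous V (x1, x2) _ nA.
have [/= B0 [B01 B02] nB1] := @add_continuous W (y1, y2) _ nB.
exists ([set xy : V * W | A0.1 xy.1 /\ B0.1 xy.2],
        [set xy : V * W | A0.2 xy.1 /\ B0.2 xy.2]) => /=.
  by split; [exists (A0.1, B0.1)|exists (A0.2, B0.2)].
move=> [[a1 b1] [a2 b2]] /= [[? ?] [? ?]].
by apply: nU; split; [exact: (nA1 (a1, a2))|exact: (nB1 (b1, b2))].
Qed.

HB.instance Definition _ (R : realType) (V W : topologicalLmodType R) :=
  PreTopologicalNmodule_isTopologicalNmodule.Build (tvs_prod V W)
    (@tvs_prod_add_continuous R V W).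

Fact tvs_prod_scale_continuous (R : realType) (V W : topologicalLmodType R) :
  continuous (fun z : R^o * tvs_prod V W => z.1 *: z.2).
Proof.
move=> [r [x y]] /= U [[A B] /= [nA nB] nU].
have [/= A0 [A01 A02] nA1] := @scale_continuous R V (r, x) _ nA.
have [/= B0 [B01 B02] nB1] := @scale_continuous R W (r, y) _ nB.
exists (A0.1 `&` B0.1, A0.2 `*` B0.2) => /=.
  by split; [exact: filterI|exists (A0.2, B0.2)].
move=> [l [e f]] /= [[? ?] [? ?]].
by apply: nU; split; [exact: (nA1 (l, e))|exact: (nB1 (l, f))].
Qed.

HB.instance Definition _ (R : realType) (V W : topologicalLmodType R) :=
  TopologicalNmodule_isTopologicalLmodule.Build R (tvs_prod V W)
    (@tvs_prod_scale_continuous R V W).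

(* The derivative of [f] at [x] in the direction [h]: the library's ['D_h f x]
   is available on normed modules only.  The value is [0] if the limit does
   not exist. *)
Definition dirder (R : realType) (V W : topologicalLmodType R)
    (f : V -> W) (x h : V) : W :=
  xget 0 [set w | (fun t : R => t^-1 *: (f (x + t *: h) - f x)) @ 0^' --> w].

(* C^k maps between open subsets of topological vector spaces, in the sense of
   Bertram, Gloeckner and Neeb: [f] is C^(k+1) if it is continuous and its
   difference quotient extends to a C^k map [f1 (x, h, t)], t = 0 included,
   where it is the directional derivative.  On locally convex spaces this is
   the Michal-Bastiani (Keller C^k_c) notion, and it is the usual one in finite
   dimension; for k = oo it also is Frechet smoothness on Banach spaces. *)
Fixpoint Ck (R : realType) (k : nat) :
    forall V W : topologicalLmodType R, set V -> (V -> W) -> Prop :=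
  match k with
  | 0%N => fun V W O f => forall x, O x -> {for x, continuous f}
  | k'.+1 => fun V W O f =>
      (forall x, O x -> {for x, continuous f}) /\
      exists f1 : tvs_prod (tvs_prod V V) R^o -> W,
        let O1 : set (tvs_prod (tvs_prod V V) R^o) :=
          [set z | O z.1.1 /\ O (z.1.1 + (z.2 : R) *: z.1.2)] in
        (forall z, O1 z ->
          f (z.1.1 + (z.2 : R) *: z.1.2) - f z.1.1 = (z.2 : R) *: f1 z) /\
        Ck k' O1 f1
  end.

Definition smooth_on (R : realType) (V W : topologicalLmodType R)
    (O : set V) (f : V -> W) : Prop := forall k, Ck k O f.

Record chart (R : realType) (T : topologicalType) (E : topologicalLmodType R) :=
  Chart {
  cdom : set T;
  cfun : T -> E;
  cinv : E -> T;
  cdom_open : open cdom;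
  ccod_open : open (cfun @` cdom);
  cfunK : forall p, cdom p -> cinv (cfun p) = p;
  cfun_continuous : forall p, cdom p -> {for p, continuous cfun};
  cinv_continuous : forall p, cdom p -> {for cfun p, continuous cinv}
}.

(* A smooth manifold without boundary, modelled on [E].  The tangent space at
   [p] is [E], a tangent vector being identified with its coordinates in the
   preferred chart [chart_at p]. *)
Record manifold (R : realType) (T : topologicalType)
    (E : topologicalLmodType R) := Manifold {
  atlas : set (chart T E);
  chart_at : T -> chart T E;
  chart_at_atlas : forall p, atlas (chart_at p);
  chart_at_dom : forall p, cdom (chart_at p) p;
  atlas_smooth : forall c c', atlas c -> atlas c' ->
    smooth_on (cfun c @` (cdom c `&` cdom c')) (cfun c' \o cinv c);
  manifold_hausdorff : hausdorff_space T
}.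

Definition smooth_from_manifold (R : realType) (T : topologicalType)
    (E V : topologicalLmodType R) (A : manifold T E) (f : T -> V) : Prop :=
  forall c, atlas A c -> smooth_on (cfun c @` cdom c) (f \o cinv c).

Definition smooth_to_manifold (R : realType) (T : topologicalType)
    (E V : topologicalLmodType R) (A : manifold T E)
    (O : set V) (f : V -> T) : Prop :=
  (forall x, O x -> {for x, continuous f}) /\
  forall c, atlas A c -> smooth_on (O `&` f @^-1` cdom c) (cfun c \o f).

(* f_* : T_p T -> V *)
Definition diff_from (R : realType) (T : topologicalType)
    (E V : topologicalLmodType R) (A : manifold T E)
    (f : T -> V) (p : T) (w : E) : V :=
  dirder (f \o cinv (chart_at A p)) (cfun (chart_at A p) p) w.

(* f_* : T_x V = V -> T_(f x) T *)
Definition diff_to (R : realType) (T : topologicalType)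
    (E V : topologicalLmodType R) (A : manifold T E)
    (f : V -> T) (x h : V) : E :=
  dirder (cfun (chart_at A (f x)) \o f) x h.

(* When [E] is infinite dimensional an immersion is also required to have a
   differential with closed complemented image; this is automatic below, where
   embeddings have a smooth left inverse. *)
Record smooth_embedding (R : realType) (T : topologicalType)
    (E V : topologicalLmodType R) (A : manifold T E) (iota : T -> V) : Prop := {
  embedding_smooth : smooth_from_manifold A iota;
  embedding_inj : injective iota;
  embedding_homeo : forall p (N : set T), nbhs p N ->
    \forall x \near iota p, forall q, iota q = x -> N q;
  embedding_immersion : forall p, injective (diff_from A iota p)
}.

(* [V] as a space of real-valued functions on [Xi], through the evaluation. *)
Definition function_space (R : realType) (Xi : Type)
    (V : topologicalLmodType R) (ev : V -> Xi -> R) : Prop :=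
  (forall (a : R) (h k : V) (xi : Xi),
    ev (a *: h + k) xi = a * ev h xi + ev k xi) /\
  injective ev.

(* The tangent spaces of the open set [M] being [V], a (possibly weak)
   Riemannian metric on [M]. *)
Record riemannian_metric (R : realType) (V : topologicalLmodType R)
    (M : set V) (g : V -> V -> V -> R) : Prop := {
  metric_linear : forall f, M f -> forall k, linear (fun h => g f h k : R^o);
  metric_sym : forall f, M f -> forall h k, g f h k = g f k h;
  metric_pos : forall f, M f -> forall h, h != 0 -> 0 < g f h h;
  metric_smooth :
    smooth_on [set z : tvs_prod (tvs_prod V V) V | M z.1.1]
      (fun z => g z.1.1 z.1.2 z.2 : R^o)
}.

Definition borel (Xi : ptopologicalType) := g_sigma_algebraType (@open Xi).

Record radon_measure (R : realType) (Xi : ptopologicalType)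
    (mu : {measure set (borel Xi) -> \bar R}) : Prop := {
  radon_compact : forall K : set Xi, compact K -> (mu K < +oo)%E;
  radon_outer : forall B : set (borel Xi), measurable B ->
    mu B = ereal_inf [set mu U | U in [set U : set Xi | open U /\ B `<=` U]];
  radon_inner : forall U : set Xi, open U ->
    mu U = ereal_sup [set mu K | K in [set K : set Xi | compact K /\ K `<=` U]]
}.

Definition strictly_positive (R : realType) (Xi : ptopologicalType)
    (mu : {measure set (borel Xi) -> \bar R}) : Prop :=
  forall U : set Xi, open U -> U !=set0 -> (0 < mu U)%E.

(* The graph of A^j, multiplication by v^j, whose domain is the set of those
   [h] for which v^j h belongs to [V]. *)
Definition velocity_mul (R : realType) (Xi : Type)
    (V : topologicalLmodType R) (ev : V -> Xi -> R) (d : nat)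
    (v : Xi -> 'rV[R]_d) (j : 'I_d) (h k : V) : Prop :=
  forall xi, ev k xi = v xi ord0 j * ev h xi.

Definition equilibria (R : realType) (V : topologicalLmodType R)
    (M : set V) (Q : V -> V) : set V := [set f | M f /\ Q f = 0].

Definition pullback_metric (R : realType) (T : topologicalType)
    (E V : topologicalLmodType R) (A : manifold T E) (g : V -> V -> V -> R)
    (iota : T -> V) (p : T) (w1 w2 : E) : R :=
  g (iota p) (diff_from A iota p w1) (diff_from A iota p w2).

(* The equilibrium set is presented as an abstract manifold [T] together with
   its embedding; [O] is the domain of the projection [pi]. *)
Record equilibrium_assumption (R : realType) (V : topologicalLmodType R)
    (M : set V) (g : V -> V -> V -> R) (Q : V -> V)
    (T : topologicalType) (E : topologicalLmodType R) (A : manifold T E)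
    (iota : T -> V) (O : set V) (pi : V -> T) : Prop := {
  eq_range : range iota = equilibria M Q;
  eq_embedding : smooth_embedding A iota;
  eq_open : open O;
  eq_sub : O `<=` M;
  eq_cover : equilibria M Q `<=` O;
  eq_pi_smooth : smooth_to_manifold A O pi;
  eq_piK : cancel iota pi;
  eq_compat : forall (p : T) (h : V) (w : E),
    g (iota p) h (diff_from A iota p w) =
    pullback_metric A g iota p (diff_to A pi (iota p) h) w
}.

Definition dual (R : realType) (V : topologicalLmodType R) : set (V -> R) :=
  [set c | linear (c : V -> R^o) /\ continuous (c : V -> R^o)].

Definition collision_invariants (R : realType) (V : topologicalLmodType R)
    (M : set V) (Q : V -> V) : set (V -> R) :=
  [set c | dual c /\ forall f, M f -> c (Q f) = 0].

Definition tvs_bounded (R : realType) (V : topologicalLmodType R)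
    (B : set V) : Prop :=
  forall N : set V, nbhs 0 N ->
    \forall t \near (0 : R), forall h, B h -> N (t *: h).

(* Neighbourhoods of 0 for the strong topology of the dual (uniform convergence
   on bounded sets); for normed [V] it is the dual norm topology. *)
Definition strong_nbhs0 (R : realType) (V : topologicalLmodType R) :
    set_system (V -> R^o) :=
  [set N | exists B : set V, exists2 e : R, tvs_bounded B & 0 < e /\
    [set c : V -> R^o | forall h, B h -> `|c h| < e] `<=` N].

(* Frechet derivative: the difference quotients converge uniformly on bounded
   sets, which on normed spaces is the usual notion.  [nW] is the system of
   neighbourhoods of 0 of the codomain. *)
Definition frechet_derivative (R : realType) (V : topologicalLmodType R)
    (W : lmodType R) (nW : set_system W) (F : V -> W) (x : V) (L : V -> W) :
    Prop :=
  [/\ linear L,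
      forall N, nW N -> \forall h \near (0 : V), N (L h)
    & forall B : set V, tvs_bounded B -> forall N, nW N ->
        \forall t \near (0 : R)^',
          forall h, B h -> N (t^-1 *: (F (x + t *: h) - F x) - L h)].

(* [dH f] and [d2H f] are the first and second Frechet derivatives of [H] at
   [f], [dH] being regarded as a map into the strong dual. *)
Record H_theorem (R : realType) (V : topologicalLmodType R)
    (M : set V) (Q : V -> V) (U : set V)
    (H : V -> R) (dH : V -> V -> R) (d2H : V -> V -> V -> R) : Prop := {
  H_open : open U;
  H_convex : convex_set (U : set (convex_lmodType V));
  H_cover : equilibria M Q `<=` U;
  H_derivative : forall f, U f ->
    frechet_derivative (nbhs (0 : R^o)) (H : V -> R^o) f (dH f : V -> R^o);
  H_derivative2 : forall f, U f ->
    (forall h, dual (d2H f h)) /\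
    frechet_derivative (@strong_nbhs0 R V)
      (dH : V -> (V -> R^o)) f (d2H f : V -> (V -> R^o));
  H_definite : forall f, U f -> forall h, h != 0 -> 0 < d2H f h h;
  H_invariant : forall f, equilibria M Q f -> collision_invariants M Q (dH f);
  H_dissipation : forall f, U f -> M f ->
    dH f (Q f) <= 0 /\ (dH f (Q f) = 0 <-> equilibria M Q f)
}.

(* As [Q] vanishes at [iota p], the covariant derivative of [Q] there is its
   directional derivative, so no connection is involved. *)
Record GWSC (R : realType) (Xi : Type) (V : topologicalLmodType R)
    (ev : V -> Xi -> R) (d : nat) (v : Xi -> 'rV[R]_d)
    (M : set V) (g : V -> V -> V -> R) (Q : V -> V)
    (T : topologicalType) (E : topologicalLmodType R) (A : manifold T E)
    (iota : T -> V) (pi : V -> T) : Prop := {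
  gwsc_tangent : forall (p : T) (h : V),
    dirder Q (iota p) (diff_from A iota p (diff_to A pi (iota p) h)) = 0;
  gwsc_normal : forall (p : T) (h : V),
    diff_from A iota p (diff_to A pi (iota p) (dirder Q (iota p) h)) = 0;
  gwsc_symmetric : forall X Y : V -> V, smooth_on M X -> smooth_on M Y ->
    forall (j : 'I_d) (f : V), M f -> forall AX AY : V,
      velocity_mul ev v j (X f) AX -> velocity_mul ev v j (Y f) AY ->
      g f AX (Y f) = g f (X f) AY;
  gwsc_dissipative : forall (p : T) (h : V),
    g (iota p) (dirder Q (iota p) h) h <= 0
}.

(* Main.v *)
(* Let p be an equilibrium.  Differentiating <dH(f'), Q[f]> = 0 along a curve
   of equilibria f' through p shows that Q[f] is g_p-orthogonal to the
   equilibrium manifold for every f, hence so is D_h Q; this is the normal part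
   of (i), the tangent part being the derivative of Q = 0 along the same curves.
   Since dH(p) annihilates Q, expanding to second order gives
     0 >= <dH(p + t h), Q[p + t h]> = t^2 g_p(h, D_h Q) + o(t^2),
   which is (v).  Finally (ii) holds because A^j is a multiplication operator
   and g an integral of products. *)

Require Import Defs.
From HB Require Import structures.
From mathcomp Require Import all_boot all_order all_algebra.
From mathcomp Require Import all_classical all_reals all_analysis.
From mathcomp Require Import ring lra.

Set Implicit Arguments.
Unset Strict Implicit.
Unset Printing Implicit Defensive.

Import Order.TTheory GRing.Theory Num.Theory.
Import numFieldNormedType.Exports.

Local Open Scope classical_set_scope.
Local Open Scope ring_scope.

(** * Limits and first-order expansions along curves *)

Lemma cvg_scale (R : realType) (V : topologicalLmodType R) (I : Type)
    (F : set_system I) {FF : Filter F} (t : I -> R) (k : I -> V)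
    (a : R) (b : V) :
  t @ F --> a -> k @ F --> b -> (fun i => t i *: k i) @ F --> a *: b.
Proof.
move=> ta kb.
exact: (@cvg_comp _ _ _ (fun i => (t i, k i)) _ F _ _ (cvg_pair ta kb)
  (@scale_continuous R V (a, b))).
Qed.

Lemma cvg_add (R : realType) (V : topologicalLmodType R) (I : Type)
    (F : set_system I) {FF : Filter F} (h k : I -> V) (a b : V) :
  h @ F --> a -> k @ F --> b -> (fun i => h i + k i) @ F --> a + b.
Proof.
move=> ha kb.
exact: (@cvg_comp _ _ _ (fun i => (h i, k i)) _ F _ _ (cvg_pair ha kb)
  (@add_continuous V (a, b))).
Qed.

(** Evaluates a continuous [k] at 0 from an identity obtained by dividing by [t], hence known for
    [t != 0] only. *)
Lemma continuous_punctured_limit (R : realType) (W : topologicalType)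
    (k q : R -> W) (a : W) :
  hausdorff_space W -> {for 0, continuous k} -> q @ 0^' --> a ->
  (\forall t \near 0^', q t = k t) -> k 0 = a.
Proof.
move=> hW k0 qa qk.
have kl : k @ 0^' --> k 0 by exact: cvg_trans (cvg_app k (cvg_within _)) k0.
have ka : k @ 0^' --> a.
  by apply: cvg_trans qa; apply: near_eq_cvg.
exact: (cvg_unique hW kl ka).
Qed.

Lemma near_curve (R : realType) (V : topologicalLmodType R) (D : set V)
    (x : V) (u : R -> V) :
  open D -> D x -> {for 0, continuous u} ->
  \forall t \near (0 : R), D (x + t *: u t).
Proof.
move=> oD Dx u0.
have : (fun t : R => x + t *: u t) @ (0 : R) --> x + 0 *: u 0.
  by apply: cvg_add; [exact: cvg_cst|apply: cvg_scale => //; exact: cvg_id].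
by rewrite scale0r addr0; apply; exact: open_nbhs_nbhs.
Qed.

Lemma near_continuous_cst (R : realType) (V : topologicalType) (x : V) :
  \forall t \near (0 : R), {for t, continuous (fun=> x)}.
Proof. by near=> t; exact: cvg_cst. Unshelve. all: end_near. Qed.

(** The coefficient [k] is the extended difference quotient [f1] along [(x, u t, t)]. The expansion
    is exact, and the direction may vary with [t]. *)
Lemma smooth_quotient (R : realType) (V W : topologicalLmodType R) (D : set V)
    (f : V -> W) (x : V) (u : R -> V) :
  hausdorff_space W -> open D -> smooth_on D f -> D x ->
  (\forall t \near (0 : R), {for t, continuous u}) ->
  exists k : R -> W,
    [/\ \forall t \near (0 : R), f (x + t *: u t) = f x + t *: k t,
        \forall t \near (0 : R), {for t, continuous k}
      & k 0 = dirder f x (u 0)].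
Proof.
move=> hW oD /(_ 1%N) [_ [f1 [f1E f1c]]] Dx uc.
have Du := near_curve oD Dx (nbhs_singleton uc).
have Du0 := near_curve oD Dx
  (nbhs_singleton (near_continuous_cst R (u 0))).
have f1_curve (w : R -> V) (t : R) :
    D (x + t *: w t) -> {for t, continuous w} ->
    {for t, continuous (fun s => f1 ((x, w s), s))}.
  move=> Dxt wt.
  have xw : (fun s => (x, w s)) @ t --> (x, w t).
    exact: cvg_pair (cvg_cst x) wt.
  have xws : (fun s : R => ((x, w s), s)) @ t --> ((x, w t), t).
    exact: (@cvg_pair _ _ _ _ _ _ _ _ _ _ id xw cvg_id).
  have f1t := f1c ((x, w t), t) (conj Dx Dxt).
  exact: (@cvg_comp _ _ _ (fun s : R => ((x, w s), s)) f1 _ _ _ xws f1t).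
exists (fun t => f1 ((x, u t), t)); split.
- apply: filterS Du => t /(conj Dx) /(f1E ((x, u t), t)) /= <-.
  by rewrite [RHS]addrC subrK.
- by apply: filterS2 Du uc => t; exact: f1_curve.
have D0 : D (x + 0 *: u 0) by rewrite scale0r addr0.
(* Freezing the direction at [u 0] keeps the value of [f1] at [t = 0], and for [t != 0] gives the
   quotients that define [dirder]. *)
have c0 := f1_curve (fun=> u 0) 0 D0
  (nbhs_singleton (near_continuous_cst R (u 0))).
have quotE : \forall t \near 0^',
    t^-1 *: (f (x + t *: u 0) - f x) = f1 ((x, u 0), t).
  near=> t.
  have Dt : D (x + t *: u 0) by near: t; exact: nbhs_dnbhs.
  rewrite (f1E ((x, u 0), t))//= scalerA mulVf ?scale1r//.
  by near: t; exact: nbhs_dnbhs_neq.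
(* A limit picked by [xget] is the value of [f1] by uniqueness; the default case is excluded because
   that value is a limit. *)
rewrite /dirder; case: xgetP => [y _ /= yP|/(_ (f1 ((x, u 0), 0))) /=].
  exact: (continuous_punctured_limit hW c0 yP).
case; apply: cvg_trans (cvg_trans (cvg_app _ (cvg_within _)) c0).
by apply: near_eq_cvg; apply: filterS quotE => t ->.
Unshelve. all: end_near. Qed.

(** The curve is the image under [f] of a straight line in the preferred chart at [p]. *)
Lemma manifold_curve (R : realType) (T : topologicalType)
    (E V : topologicalLmodType R) (A : manifold T E) (f : T -> V) (p : T)
    (w : E) :
  hausdorff_space V -> smooth_from_manifold A f ->
  exists k : R -> V,
    [/\ \forall t \near (0 : R), range f (f p + t *: k t),
        \forall t \near (0 : R), {for t, continuous k}
      & k 0 = diff_from A f p w].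
Proof.
move=> hV hf; pose c := chart_at A p.
have cp : cdom c p := chart_at_dom A p.
have [k [kE kc k0]] := smooth_quotient hV (ccod_open c)
  (hf c (chart_at_atlas A p)) (ex_intro2 _ _ p cp erefl)
  (near_continuous_cst R w).
exists k; split => //; apply: filterS kE => t /=.
by rewrite (cfunK cp) => <-; eexists.
Qed.

(** The image of a compact segment is bounded: scaling is continuous at each [(0, k s)], and
    compactness makes the smallness of the scalar uniform in [s]. *)
Lemma curve_bounded (R : realType) (V : topologicalLmodType R) (k : R -> V) :
  (\forall t \near (0 : R), {for t, continuous k}) ->
  exists2 B : set V, tvs_bounded B & \forall t \near (0 : R), B (k t).
Proof.
move=> /nbhs_ballP[e /= e0 ke].
(* Halving [e] keeps the closed segment inside the ball on which [k] is continuous. *)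
exists (k @` `[- (e / 2), e / 2]).
  move=> N N0.
  have := (compact_near_coveringP _).1 (@segment_compact R (- (e / 2)) (e / 2)).
  move=> /(_ R (nbhs (0 : R)) (fun t s => N (t *: k s)) _).
  have H : (forall x : R, [set` `[- (e / 2), (e / 2)]] x ->
    \forall x' \near x & i \near (0 : R), N (i *: k x')).
    move=> s /=; rewrite in_itv /= => /andP[s1 s2].
    have sc : {for s, continuous k}.
      apply: ke; rewrite /ball /= sub0r normrN.
      by apply: le_lt_trans (_ : e / 2 < _); rewrite ?ler_norml ?s1//; lra.
    have kp : (fun p : R * R => k p.1) @ (s, 0 : R) --> k s.
      exact: (@cvg_comp _ _ _ (@fst R R) k _ _ _
        (@cvg_fst _ _ (nbhs s) (nbhs (0 : R)) _) sc).
    have : (fun p : R * R => p.2 *: k p.1) @ (s, 0 : R) --> 0 *: k s.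
      apply: (@cvg_scale R V _ (nbhs (s, 0 : R)) _ snd) => //.
      exact: (@cvg_snd _ _ (nbhs s) (nbhs (0 : R)) _).
    by move=> /(_ N); rewrite scale0r => /(_ N0).
  move=> /(_ H) {}H.
  by apply: filterS H => t tN _ [s sI <-]; exact: tN.
have e2 : 0 < e / 2 by lra.
near=> t; exists t => //=; rewrite in_itv /= -ler_norml.
near: t; have := @nbhs0_le R R^o _ e2; exact.
Unshelve. all: end_near. Qed.

(* The derivative into the strong dual is uniform over bounded sets of
   increments and of test vectors, so both may vary along a curve. *)
Lemma strong_derivative_along_curves (R : realType)
    (V : topologicalLmodType R) (F : V -> V -> R) (x : V) (L : V -> V -> R)
    (k q : R -> V) :
  frechet_derivative (@strong_nbhs0 R V)
    (F : V -> (V -> R^o)) x (L : V -> (V -> R^o)) ->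
  (\forall t \near (0 : R), {for t, continuous k}) ->
  (\forall t \near (0 : R), {for t, continuous q}) ->
  (fun t : R => t^-1 * (F (x + t *: k t) (q t) - F x (q t)) - L (k t) (q t))
    @ 0^' --> (0 : R).
Proof.
move=> [_ _ FL] /curve_bounded[B Bb Bk] /curve_bounded[C Cb Cq].
apply/cvgrPdist_lt => e e0.
have := FL B Bb [set c : V -> R^o | forall h, C h -> `|c h| < e].
move=> /(_ (ex_intro _ C (ex_intro2 _ _ e Cb (conj e0 _)))) H.
have {}H := H (fun _ => id).
near=> t; rewrite sub0r normrN.
have Bt : B (k t) by near: t; exact: nbhs_dnbhs.
have Ct : C (q t) by near: t; exact: nbhs_dnbhs.
have : forall h, B h -> forall c, C c ->
  `|(t^-1 *: ((F : V -> (V -> R^o)) (x + t *: h) - F x) - L h) c| < e.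
  by near: t; exact: H.
exact.
Unshelve. all: end_near. Qed.

(** * Homogeneity, continuity and separation from the metric *)

Lemma linear_scale (R : realType) (V : lmodType R) (c : V -> R) :
  linear (c : V -> R^o) -> forall a x, c (a *: x) = a * c x.
Proof.
move=> cl a x.
pose G : {linear V -> R^o} := HB.pack (c : V -> R^o)
  (GRing.isLinear.Build _ _ _ _ _ cl).
exact: (linearZ_LR G).
Qed.

Lemma metric_scaler (R : realType) (V : topologicalLmodType R) (M : set V)
    (g : V -> V -> V -> R) (f h k : V) (a : R) :
  riemannian_metric M g -> M f -> g f h (a *: k) = a * g f h k.
Proof.
move=> hg Mf; rewrite !(Defs.metric_sym hg Mf h).
exact: linear_scale (metric_linear hg Mf h) _ _.
Qed.

Lemma metric_continuous (R : realType) (V : topologicalLmodType R) (M : set V)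
    (g : V -> V -> V -> R) (f : V) (I : Type) (F : set_system I) {FF : Filter F}
    (h k : I -> V) (a b : V) :
  riemannian_metric M g -> M f -> h @ F --> a -> k @ F --> b ->
  (fun i => g f (h i) (k i)) @ F --> g f a b.
Proof.
move=> hg Mf ha kb.
have gc := metric_smooth hg 0 ((f, a), b) Mf.
have fh : (fun i => (f, h i)) @ F --> (f, a) by exact: cvg_pair (cvg_cst f) ha.
have fhk : (fun i => ((f, h i), k i)) @ F --> ((f, a), b).
  exact: cvg_pair fh kb.
exact: (@cvg_comp _ _ _ (fun i => ((f, h i), k i)) (fun z => g z.1.1 z.1.2 z.2)
  _ _ _ fhk gc).
Qed.

(** The continuous function [g f (x - b) (x - b)] vanishes at [b] and is positive at any other
    point. This supplies the uniqueness of limits in [V]. *)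
Lemma metric_hausdorff (R : realType) (V : topologicalLmodType R) (M : set V)
    (g : V -> V -> V -> R) (f : V) :
  riemannian_metric M g -> M f -> hausdorff_space V.
Proof.
move=> hg Mf a b clab; apply/eqP/negPn/negP => ab.
pose r (x : V) := g f (x - b) (x - b).
have rc : continuous r.
  move=> x.
  have xb : (fun y : V => y - b) @ x --> x - b.
    by apply: cvg_add; [exact: cvg_id|exact: cvg_cst].
  exact: (metric_continuous hg Mf xb xb).
have ra : 0 < r a by apply: (metric_pos hg) => //; rewrite subr_eq0.
have rb : r b = 0.
  by rewrite /r subrr -(scale0r 0) (metric_scaler _ _ _ hg Mf) mul0r.
have Na : nbhs a [set x | r a / 2 < r x].
  by apply: (cvgr_gt _ (rc a)); lra.
have Nb : nbhs b [set x | r x < r a / 2].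
  by apply: (cvgr_lt _ (rc b)); lra.
by have [x [/= /lt_trans + ]] := clab _ _ Na Nb => /[apply]; rewrite ltxx.
Qed.

(** * The stability conditions at equilibria *)

Theorem theorem8 (R : realType)
  (n : nat) (Xi : ptopologicalType) (AXi : manifold Xi 'rV[R]_n)
  (hXi : @second_countable Xi)
  (d : nat) (v : Xi -> 'rV[R]_d)
  (V : topologicalLmodType R) (ev : V -> Xi -> R) (hV : function_space ev)
  (M : set V) (hM : open M)
  (g : V -> V -> V -> R) (hg : riemannian_metric M g)
  (Q : V -> V) (hQ : smooth_on M Q)
  (T : topologicalType) (E : topologicalLmodType R) (A : manifold T E)
  (iota : T -> V) (O : set V) (pi : V -> T)
  (hE : equilibrium_assumption M g Q A iota O pi)
  (U : set V) (H : V -> R) (dH : V -> V -> R) (d2H : V -> V -> V -> R)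
  (hH : H_theorem M Q U H dH d2H)
  (hmu : forall f, M f -> exists mu : {measure set (borel Xi) -> \bar R},
    [/\ radon_measure mu, strictly_positive mu
      & forall h1 h2 : V,
          mu.-integrable setT (fun xi => (ev h1 xi * ev h2 xi)%:E) /\
          (g f h1 h2)%:E =
            (\int[mu]_(xi in setT) (ev h1 xi * ev h2 xi)%:E)%E])
  (hgH : forall (p : T) (h1 h2 : V), g (iota p) h1 h2 = d2H (iota p) h1 h2) :
  GWSC ev v M g Q A iota pi.
Proof.
have Meq p : M (iota p) /\ Q (iota p) = 0.
  have : equilibria M Q (iota p) by rewrite -(eq_range hE); exists p.
  by [].
have hVs (p : T) : hausdorff_space V := metric_hausdorff hg (Meq p).1.
have Up p : U (iota p) by apply: (H_cover hH); exact: Meq.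
have curve (p : T) (w : E) : exists k : R -> V,
    [/\ \forall t \near (0 : R), equilibria M Q (iota p + t *: k t),
        \forall t \near (0 : R), {for t, continuous k}
      & k 0 = diff_from A iota p w].
  rewrite -(eq_range hE).
  exact: manifold_curve (hVs p) (embedding_smooth (eq_embedding hE)).
have orth (p : T) (w : E) f :
    M f -> g (iota p) (diff_from A iota p w) (Q f) = 0.
  move=> Mf.
  have [k [kM kc <-]] := curve p w.
  have [_ dH2] := H_derivative2 hH (Up p).
  have lim0 := strong_derivative_along_curves dH2 kc
    (near_continuous_cst R (Q f)).
  have gc : {for 0, continuous (fun t => g (iota p) (k t) (Q f))}.
    exact: (metric_continuous hg (Meq p).1 (nbhs_singleton kc) (cvg_cst _)).
  (* Both base points are equilibria, so both [dH] terms vanish on [Q f] and the negated expression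
     is exactly [g (iota p) (k t) (Q f)]. *)
  have /(_ (dnbhs_filter _)) := cvgN lim0; rewrite oppr0 => lim0N.
  apply: (@continuous_punctured_limit R R
    (fun t => g (iota p) (k t) (Q f)) _ _ (@Rhausdorff R) gc lim0N).
  near=> t.
  have kt : equilibria M Q (iota p + t *: k t) by near: t; exact: nbhs_dnbhs.
  rewrite opprfctE; have [_ ->//] := H_invariant hH kt.
  have [_ ->//] := H_invariant hH (Meq p).
  by rewrite subrr mulr0 sub0r /= opprK hgH.
have Qcurve (p : T) (h : V) := smooth_quotient (hVs p) hM hQ (Meq p).1
  (near_continuous_cst R h).
have Ucurve (p : T) (h : V) : \forall t \near (0 : R), U (iota p + t *: h).
  exact: near_curve (H_open hH) (Up p)
    (nbhs_singleton (near_continuous_cst R h)).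
have Mcurve (p : T) (h : V) : \forall t \near (0 : R), M (iota p + t *: h).
  exact: near_curve hM (Meq p).1 (nbhs_singleton (near_continuous_cst R h)).
split.
- move=> p h.
  (* Along a curve of equilibria the expansion of [Q] reads [0 = t *: k t], so [k] vanishes off 0
     and, by continuity, at 0. *)
  have [u [uM uc <-]] := curve p (diff_to A pi (iota p) h).
  have [k [kE kc <-]] := smooth_quotient (hVs p) hM hQ (Meq p).1 uc.
  apply: (continuous_punctured_limit (hVs p) (nbhs_singleton kc) (cvg_cst 0)).
  near=> t.
  have t0 : t != 0 by near: t; exact: nbhs_dnbhs_neq.
  have : Q (iota p + t *: u t) = Q (iota p) + t *: k t.
    by near: t; exact: nbhs_dnbhs.
  have [_ ->] : equilibria M Q (iota p + t *: u t).
    by near: t; exact: nbhs_dnbhs.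
  by rewrite (Meq p).2 add0r => /esym/eqP; rewrite scaler_eq0 (negbTE t0) =>
    /eqP ->.
- move=> p h.
  have gDQ w : g (iota p) (diff_from A iota p w) (dirder Q (iota p) h) = 0.
    have [k [kE kc <-]] := Qcurve p h.
    have gc : {for 0, continuous
        (fun t => g (iota p) (diff_from A iota p w) (k t))}.
      exact: (metric_continuous hg (Meq p).1 (cvg_cst _) (nbhs_singleton kc)).
    (* Since [Q (iota p + t *: h) = t *: k t], orthogonality of [Q] passes to [k t], then to its
       value at 0. *)
    apply: (@continuous_punctured_limit R R
      (fun t => g (iota p) (diff_from A iota p w) (k t))
      _ _ (@Rhausdorff R) gc (cvg_cst 0)).
    near=> t.
    have t0 : t != 0 by near: t; exact: nbhs_dnbhs_neq.
    have Qt : Q (iota p + t *: h) = t *: k t.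
      by rewrite -[RHS]add0r -(Meq p).2; near: t; exact: nbhs_dnbhs.
    have Mt : M (iota p + t *: h) by near: t; exact: nbhs_dnbhs (Mcurve p h).
    have /eqP := orth p w _ Mt.
    by rewrite Qt (metric_scaler _ _ _ hg (Meq p).1) mulf_eq0 (negbTE t0) =>
      /eqP ->.
  (* Compatibility of the projection, tested on [e] itself, equates the squared norm of the
     projected vector with a product that [gDQ] makes zero. *)
  set e := diff_to _ _ _ _.
  have := eq_compat hE p (dirder Q (iota p) h) e.
  rewrite (Defs.metric_sym hg (Meq p).1) gDQ /pullback_metric -/e => /esym g0.
  apply/eqP/negPn/negP => /(metric_pos hg (Meq p).1).
  by rewrite g0 ltxx.
- move=> X Y _ _ j f Mf AX AY vX vY.
  have [mu [_ _ gmu]] := hmu f Mf.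
  apply: EFin_inj; rewrite (gmu _ _).2 (gmu _ _).2.
  (* Both integrands are the same product with the factor [v xi ord0 j]. *)
  by apply: eq_integral => xi _; rewrite vX vY; rewrite mulrCA mulrA.
- move=> p h.
  have [q [qE qc <-]] := Qcurve p h.
  have [_ dH2] := H_derivative2 hH (Up p).
  have lim0 := strong_derivative_along_curves dH2
    (near_continuous_cst R h) qc.
  have limg : (fun t => g (iota p) h (q t)) @ 0^' --> g (iota p) h (q 0).
    apply: (metric_continuous hg (Meq p).1); first exact: cvg_cst.
    exact: cvg_trans (cvg_app q (cvg_within _)) (nbhs_singleton qc).
  rewrite (Defs.metric_sym hg (Meq p).1).
  (* Adding the metric term back cancels [d2H], leaving the quotient of [dH] tested on the moving
     vector [q t], whose limit is the quantity to be signed. *)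
  have /(_ (dnbhs_filter _)) := cvgD lim0 limg; rewrite add0r => lim.
  rewrite -(cvg_lim (@Rhausdorff R) lim).
  apply: limr_le; first exact: cvgP lim.
  near=> t => /=.
  rewrite addrfctE hgH subrK.
  have t0 : t != 0 by near: t; exact: nbhs_dnbhs_neq.
  have Qt : Q (iota p + t *: h) = t *: q t.
    by rewrite -[RHS]add0r -(Meq p).2; near: t; exact: nbhs_dnbhs.
  have Mt : M (iota p + t *: h) by near: t; exact: nbhs_dnbhs (Mcurve p h).
  have Ut : U (iota p + t *: h) by near: t; exact: nbhs_dnbhs (Ucurve p h).
  have dHZ f : U f -> dH f (t *: q t) = t * dH f (q t).
    move=> /(H_derivative hH) [dHl _ _].
    exact: linear_scale.
  have /eqP : dH (iota p) (t *: q t) = 0.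
    by rewrite -Qt; have [_ ->] := H_invariant hH (Meq p).
  rewrite dHZ// mulf_eq0 (negbTE t0) => /eqP ->; rewrite subr0.
  have [+ _] := H_dissipation hH Ut Mt; rewrite Qt dHZ// => S0.
  (* The quotient is the dissipation at [iota p + t *: h] divided by [t ^+ 2], so its sign does not
     depend on that of [t]. *)
  have -> : t^-1 * dH (iota p + t *: h) (q t) =
      t^-1 ^+ 2 * (t * dH (iota p + t *: h) (q t)) by field.
  by rewrite mulr_ge0_le0// sqr_ge0.
Unshelve. all: end_near. Qed.
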